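(* Let $\mathfrak g$ be a symmetrizable Kac--Moody algebra, $\lambda$ a dominant weight and $R^\lambda$ the cyclotomic quiver Hecke algebra. The map $\mathrm{tr}_\lambda:R^\lambda\to\mathbb K$ given by closing a diagram at the right (and by $0$ on diagrams whose top and bottom do not match) is a Frobenius trace, i.e. its kernel contains no nonzero left ideal.
   Context: **Data.** $\mathfrak g$ has Dynkin vertex set $\Gamma$, simple roots $\alpha_i$, coroots $\alpha_i^\vee$, $c_{ij}=\alpha_i^\vee(\alpha_j)$, $2d_i=\langle\alpha_i,\alpha_i\rangle$ for the symmetrized form, $\mu^i=\alpha_i^\vee(\mu)$. $\mathbb K$ is a field. Fix $Q_{ij}\in\mathbb K[u,v]$ with $Q_{ii}=0$, $Q_{ij}(u,v)=Q_{ji}(v,u)$ and, for $i\neq j$, $Q_{ij}$ homogeneous of degree $-2d_ic_{ij}$ for $\deg u=2d_i,\deg v=2d_j$, with nonzero coefficient $t_{ij}$ of $u^{-c_{ij}}$. **$R^\lambda$.** The quiver Hecke algebra $R$ is generated by orthogonal idempotents $e=e(\mathbf i)$ ($\mathbf i\in\Gamma^n$, $n\ge0$), commuting dots $y_ke$ ($1\le k\le n$), and crossings $\psi_ke=e(s_k\mathbf i)\psi_ke$ ($1\le k<n$), with $\psi_k\psi_m=\psi_m\psi_k$ for $|k-m|>1$; $\psi_ky_me=y_{s_k(m)}\psi_ke$ unless $i_k=i_{k+1}$ and $m\in\{k,k+1\}$; $(y_k\psi_k-\psi_ky_{k+1})e=e=(\psi_ky_k-y_{k+1}\psi_k)e$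 if $i_k=i_{k+1}$; $\psi_k^2e=Q_{i_ki_{k+1}}(y_k,y_{k+1})e$; $(\psi_k\psi_{k+1}\psi_k-\psi_{k+1}\psi_k\psi_{k+1})e=\frac{Q_{i_ki_{k+1}}(y_{k+2},y_{k+1})-Q_{i_ki_{k+1}}(y_k,y_{k+1})}{y_{k+2}-y_k}e$ if $i_k=i_{k+2}\neq i_{k+1}$, and $0$ otherwise. $R^\lambda$ is its quotient by the ideal generated by all $y_1^{\lambda^{i_1}}e(\mathbf i)$. $R^\lambda_\mu$ is the summand with $\lambda-\sum_k\alpha_{i_k}=\mu$; $R^\lambda_\lambda\cong\mathbb K$. **Closing.** The categories of finitely generated projective right $R^\lambda_\mu$-modules carry an action of the Khovanov--Lauda 2-category $\mathcal U$ attached to $\mathfrak g$ and the $Q_{ij}$ (in the form of Cautis--Lauda, with parameters $r_i=1$), in which $\mathcal F_i$ is induction along the map $\nu_i:R^\lambda_\mu\to R^\lambda_{\mu-\alpha_i}$ adding a strand labeled $i$ at the right, and $\mathcal E_i$ is restriction along $\nu_i$. In $\mathcal U$ these 1-morphisms are biadjoint with given units and counits (cups and caps), satisfying the normalization that every dotted bubble of negative degree is zero and every bubble of degree $0$ is $1$. Let $\tilde\eta_i:1\to\mathcal E_i\mathcal F_i$ be the unit of the adjunction with $\mathcal F_i$ left adjoint to $\mathcal E_i$ (given on $R^\lambda_\mu$ by $\nu_i$) and $\varepsilon_i:\mathcal E_i\mathcal F_i\to1$ the counit of the adjunction with $\mathcal E_i$ left adjoint to $\mathcal F_i$. An element $a\in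 e(\mathbf i)R^\lambda e(\mathbf i)$ with $\mathbf i=(i_1,\dots,i_n)$ acts on the functor $\mathcal F_{i_n}\cdots\mathcal F_{i_1}$, and $\mathrm{tr}_\lambda(a)\in\mathrm{End}(R^\lambda_\lambda)=\mathbb K$ is the composite $\mathrm{id}\to\mathcal E_{i_1}\cdots\mathcal E_{i_n}\mathcal F_{i_n}\cdots\mathcal F_{i_1}\xrightarrow{\ a\ }\mathcal E_{i_1}\cdots\mathcal E_{i_n}\mathcal F_{i_n}\cdots\mathcal F_{i_1}\to\mathrm{id}$ built from the nested $\tilde\eta$'s and $\varepsilon$'s, evaluated on $R^\lambda_\lambda\cong\mathbb K$. On $e(\mathbf i)R^\lambda e(\mathbf j)$ with $\mathbf i\ne\mathbf j$ the map is zero. *)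

(* Defs.v *)
From HB Require Import structures.
From mathcomp Require Import all_boot all_order all_algebra.
From mathcomp Require Import generic_quotient polyXY.
From mathcomp Require Import boolp classical_sets fsbigop.

Set Implicit Arguments.
Unset Strict Implicit.
Unset Printing Implicit Defensive.

Import GRing.Theory.
Local Open Scope quotient_scope.
Local Open Scope ring_scope.

(* Nonunital associative K-algebras presented by generators and relations:    *)
(* the quotient of formal algebra expressions by the smallest congruence      *)
(* containing the relations rel and the nonunital K-algebra axioms.           *)
Section Presentation.
Variables (K : fieldType) (G : Type).

Inductive expr : Type :=
  | EGen of G
  | EZero
  | EAdd of expr & expr
  | EScale of K & expr
  | EMul of expr & expr.

HB.instance Definition _ := gen_eqMixin expr.
HB.instance Definition _ := gen_choiceMixin expr.

Variable rel : expr -> expr -> Prop.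

Inductive pres_eq : expr -> expr -> Prop :=
  | pres_rel x y of rel x y : pres_eq x y
  | pres_refl x : pres_eq x x
  | pres_sym x y of pres_eq x y : pres_eq y x
  | pres_trans x y z of pres_eq x y & pres_eq y z : pres_eq x z
  | pres_add x x' y y' of pres_eq x x' & pres_eq y y' :
      pres_eq (EAdd x y) (EAdd x' y')
  | pres_scale a x x' of pres_eq x x' : pres_eq (EScale a x) (EScale a x')
  | pres_mul x x' y y' of pres_eq x x' & pres_eq y y' :
      pres_eq (EMul x y) (EMul x' y')
  | pres_addA x y z : pres_eq (EAdd x (EAdd y z)) (EAdd (EAdd x y) z)
  | pres_addC x y : pres_eq (EAdd x y) (EAdd y x)
  | pres_add0 x : pres_eq (EAdd EZero x) x
  | pres_addN x : pres_eq (EAdd (EScale (-1) x) x) EZero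
  | pres_scaleA a b x : pres_eq (EScale a (EScale b x)) (EScale (a * b) x)
  | pres_scale1 x : pres_eq (EScale 1 x) x
  | pres_scaleDr a x y :
      pres_eq (EScale a (EAdd x y)) (EAdd (EScale a x) (EScale a y))
  | pres_scaleDl a b x :
      pres_eq (EScale (a + b) x) (EAdd (EScale a x) (EScale b x))
  | pres_mulA x y z : pres_eq (EMul x (EMul y z)) (EMul (EMul x y) z)
  | pres_mulDl x y z : pres_eq (EMul (EAdd x y) z) (EAdd (EMul x z) (EMul y z))
  | pres_mulDr x y z : pres_eq (EMul x (EAdd y z)) (EAdd (EMul x y) (EMul x z))
  | pres_scaleAl a x y : pres_eq (EMul (EScale a x) y) (EScale a (EMul x y))
  | pres_scaleAr a x y : pres_eq (EMul x (EScale a y)) (EScale a (EMul x y)).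

Definition pres_eqb (x y : expr) := `[< pres_eq x y >].

Fact pres_eqb_refl : reflexive pres_eqb.
Proof. by move=> x; apply/asboolP/pres_refl. Qed.
Fact pres_eqb_sym : symmetric pres_eqb.
Proof. by move=> x y; apply/asboolP/asboolP=> /pres_sym. Qed.
Fact pres_eqb_trans : transitive pres_eqb.
Proof.
by move=> y x z /asboolP xy /asboolP yz; apply/asboolP/(pres_trans xy yz).
Qed.

Canonical pres_equiv := EquivRel pres_eqb
  pres_eqb_refl pres_eqb_sym pres_eqb_trans.

Definition presented : Type := {eq_quot pres_equiv}.

HB.instance Definition _ := Choice.on presented.
HB.instance Definition _ := EqQuotient.on presented.

Definition pclass (x : expr) : presented := \pi_({eq_quot pres_equiv})%qT x.
Definition prepr (x : presented) : expr := repr x.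

Lemma pclassP x y : pres_eq x y <-> pclass x = pclass y.
Proof.
split=> [xy|/eqmodP/asboolP//].
by apply/eqmodP/asboolP.
Qed.

Lemma preprK x : pclass (prepr x) = x.
Proof. exact: reprK. Qed.

Lemma pclass_repr x : pres_eq (prepr (pclass x)) x.
Proof. by apply/pclassP; rewrite preprK. Qed.

Lemma pclass_ind (P : presented -> Prop) : (forall x, P (pclass x)) -> forall x, P x.
Proof. by move=> H x; rewrite -(preprK x). Qed.

Definition padd x y := pclass (EAdd (prepr x) (prepr y)).
Definition popp x := pclass (EScale (-1) (prepr x)).
Definition pscale a x := pclass (EScale a (prepr x)).
Definition pmul x y := pclass (EMul (prepr x) (prepr y)).

Lemma paddE x y : padd (pclass x) (pclass y) = pclass (EAdd x y).
Proof. by apply/pclassP/pres_add; apply: pclass_repr. Qed.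
Lemma poppE x : popp (pclass x) = pclass (EScale (-1) x).
Proof. by apply/pclassP/pres_scale; apply: pclass_repr. Qed.
Lemma pscaleE a x : pscale a (pclass x) = pclass (EScale a x).
Proof. by apply/pclassP/pres_scale; apply: pclass_repr. Qed.
Lemma pmulE x y : pmul (pclass x) (pclass y) = pclass (EMul x y).
Proof. by apply/pclassP/pres_mul; apply: pclass_repr. Qed.

Fact paddA : associative padd.
Proof.
elim/pclass_ind=> x; elim/pclass_ind=> y; elim/pclass_ind=> z.
by rewrite !paddE; apply/pclassP/pres_addA.
Qed.
Fact paddC : commutative padd.
Proof.
elim/pclass_ind=> x; elim/pclass_ind=> y.
by rewrite !paddE; apply/pclassP/pres_addC.
Qed.
Fact padd0 : left_id (pclass EZero) padd.
Proof. by elim/pclass_ind=> x; rewrite paddE; apply/pclassP/pres_add0. Qed.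
Fact paddN : left_inverse (pclass EZero) popp padd.
Proof.
by elim/pclass_ind=> x; rewrite poppE paddE; apply/pclassP/pres_addN.
Qed.

HB.instance Definition _ :=
  GRing.isZmodule.Build presented paddA paddC padd0 paddN.

Fact pscaleA a b v : pscale a (pscale b v) = pscale (a * b) v.
Proof.
by elim/pclass_ind: v => x; rewrite !pscaleE; apply/pclassP/pres_scaleA.
Qed.
Fact pscale1 : left_id 1 pscale.
Proof. by elim/pclass_ind=> x; rewrite pscaleE; apply/pclassP/pres_scale1. Qed.
Fact pscaleDr : right_distributive pscale +%R.
Proof.
move=> a; elim/pclass_ind=> x; elim/pclass_ind=> y.
by rewrite /GRing.add /= paddE !pscaleE paddE; apply/pclassP/pres_scaleDr.
Qed.
Fact pscaleDl v : {morph pscale^~ v : a b / a + b}.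
Proof.
move=> a b; elim/pclass_ind: v => x.
by rewrite [RHS]/GRing.add /= !pscaleE paddE; apply/pclassP/pres_scaleDl.
Qed.

HB.instance Definition _ := GRing.Zmodule_isLmodule.Build K presented
  pscaleA pscale1 pscaleDr pscaleDl.

Lemma pclassD x y : pclass (EAdd x y) = pclass x + pclass y.
Proof. by rewrite -paddE. Qed.
Lemma pclassZ a x : pclass (EScale a x) = a *: pclass x.
Proof. by rewrite -pscaleE. Qed.
Lemma pclassM x y : pclass (EMul x y) = pmul (pclass x) (pclass y).
Proof. by rewrite pmulE. Qed.

Lemma pmulA : associative pmul.
Proof.
elim/pclass_ind=> x; elim/pclass_ind=> y; elim/pclass_ind=> z.
by rewrite !pmulE; apply/pclassP/pres_mulA.
Qed.
Lemma pmulDl : left_distributive pmul +%R.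
Proof.
elim/pclass_ind=> x; elim/pclass_ind=> y; elim/pclass_ind=> z.
by rewrite -pclassD !pmulE -pclassD; apply/pclassP/pres_mulDl.
Qed.
Lemma pmulDr : right_distributive pmul +%R.
Proof.
elim/pclass_ind=> x; elim/pclass_ind=> y; elim/pclass_ind=> z.
by rewrite -pclassD !pmulE -pclassD; apply/pclassP/pres_mulDr.
Qed.
Lemma pscaleAl a x y : pmul (a *: x) y = a *: pmul x y.
Proof.
elim/pclass_ind: x => x; elim/pclass_ind: y => y.
by rewrite -pclassZ !pmulE -pclassZ; apply/pclassP/pres_scaleAl.
Qed.
Lemma pscaleAr a x y : pmul x (a *: y) = a *: pmul x y.
Proof.
elim/pclass_ind: x => x; elim/pclass_ind: y => y.
by rewrite -pclassZ !pmulE -pclassZ; apply/pclassP/pres_scaleAr.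
Qed.

Lemma pmul0l x : pmul 0 x = 0.
Proof. by rewrite -[in LHS](scale0r 0) pscaleAl scale0r. Qed.
Lemma pmul0r x : pmul x 0 = 0.
Proof. by rewrite -[in LHS](scale0r 0) pscaleAr scale0r. Qed.

End Presentation.

Arguments EZero {K G}.
Arguments EGen {K G}.
Declare Scope expr_scope.
Delimit Scope expr_scope with E.
Bind Scope expr_scope with expr.
Notation "x + y" := (EAdd x y) : expr_scope.
Notation "x - y" := (EAdd x (EScale (-1) y)) : expr_scope.
Notation "a *: x" := (EScale a x) : expr_scope.
Notation "x ** y" := (EMul x y) (at level 40, left associativity) : expr_scope.
Notation "x ** y" := (pmul x y) : ring_scope.

(* A symmetrizable generalized Cartan matrix with a realization. Only         *)
(* proportions of the symmetrizer d matter, so it is allowed to be rational.  *)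
Record kmDatum := KMDatum {
  dynkin : finType;
  wtlat : zmodType;
  sroot : dynkin -> wtlat;
  scoroot : dynkin -> {additive wtlat -> int};
  symd : dynkin -> rat;
  cartan := fun i j => scoroot i (sroot j);
  cartan_diag : forall i, cartan i i = 2;
  cartan_off : forall i j, i != j -> cartan i j <= 0;
  cartan_eq0 : forall i j, cartan i j = 0 -> cartan j i = 0;
  symd_gt0 : forall i, 0 < symd i;
  symdP : forall i j, symd i * (cartan i j)%:~R = symd j * (cartan j i)%:~R;
  sroot_free : forall a : dynkin -> int,
    \sum_i sroot i *~ a i = 0 -> forall i, a i = 0;
  scoroot_free : forall a : dynkin -> int,
    (forall mu, \sum_i a i * scoroot i mu = 0) -> forall i, a i = 0
}.

Definition dominant (D : kmDatum) (lam : wtlat D) :=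
  forall i : dynkin D, 0 <= scoroot i lam.

Section QuiverParams.
Variables (D : kmDatum) (K : fieldType).
Variable Q : dynkin D -> dynkin D -> {poly {poly K}}.

(* In {poly {poly K}} the variable u is the inner one and v the outer one:    *)
(* (Q i j)`_b`_a is the coefficient of u^a v^b.                               *)
Definition tcoef i j : K := (Q i j)`_0`_(absz (cartan i j)).

Definition Qparams : Prop :=
  [/\ forall i, Q i i = 0,
      forall i j, Q i j = swapXY (Q j i),
      forall i j, i != j -> forall a b, (Q i j)`_b`_a != 0 ->
        2 * symd i * a%:R + 2 * symd j * b%:R
          = - (2 * symd i * (cartan i j)%:~R) :> rat
    & forall i j, i != j -> tcoef i j != 0].

End QuiverParams.

Fixpoint swap_at (T : Type) (k : nat) (s : seq T) : seq T :=
  match k, s with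
  | 0, a :: b :: s' => b :: a :: s'
  | k'.+1, a :: s' => a :: swap_at k' s'
  | _, _ => s
  end.

Definition adj_transp (k m : nat) : nat :=
  if m == k then k.+1 else if m == k.+1 then k else m.

Section QuiverHecke.
Variables (D : kmDatum) (K : fieldType).
Variable Q : dynkin D -> dynkin D -> {poly {poly K}}.
Notation I := (dynkin D).

(* QHe s is e(s), QHy k s is y_k e(s) and QHpsi k s is psi_k e(s). Strands    *)
(* are numbered from 0, and a dot or a crossing whose index is out of range   *)
(* is set to 0 by the relations.                                              *)
Inductive qh_gen : Type :=
  | QHe of seq I
  | QHy of nat & seq I
  | QHpsi of nat & seq I.

Notation qexpr := (expr K qh_gen).
Definition xe s : qexpr := EGen (QHe s).
Definition xy k s : qexpr := EGen (QHy k s).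
Definition xpsi k s : qexpr := EGen (QHpsi k s).

Local Open Scope expr_scope.

(* y_k^a x, for x in e(s)R *)
Definition xyn k s (a : nat) (x : qexpr) := iter a (EMul (xy k s)) x.

(* p(y_k, y_l) e(s) *)
Definition xeval (p : {poly {poly K}}) k l s : qexpr :=
  \big[@EAdd K qh_gen/EZero]_(b < size p)
    \big[@EAdd K qh_gen/EZero]_(a < size p`_b)
      (p`_b`_a *: xyn k s a (xyn l s b (xe s))).

(* (p(y_m, y_l) - p(y_k, y_l)) / (y_m - y_k) e(s), expanded with              *)
(* (w^a - u^a) / (w - u) = \sum_(c < a) w^c u^(a - 1 - c)                     *)
Definition xdivdiff (p : {poly {poly K}}) k l m s : qexpr :=
  \big[@EAdd K qh_gen/EZero]_(b < size p)
    \big[@EAdd K qh_gen/EZero]_(a < size p`_b)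
      \big[@EAdd K qh_gen/EZero]_(c < a)
        (p`_b`_a *: xyn m s c (xyn k s (a.-1 - c) (xyn l s b (xe s)))).

Inductive qh_rel : qexpr -> qexpr -> Prop :=
  | qh_ee s : qh_rel (xe s ** xe s) (xe s)
  | qh_ee0 s t of s <> t : qh_rel (xe s ** xe t) EZero
  | qh_y0 k s of (size s <= k)%N : qh_rel (xy k s) EZero
  | qh_psi0 k s of (size s <= k.+1)%N : qh_rel (xpsi k s) EZero
  | qh_ye k s : qh_rel (xy k s ** xe s) (xy k s)
  | qh_ey k s : qh_rel (xe s ** xy k s) (xy k s)
  | qh_psie k s : qh_rel (xpsi k s ** xe s) (xpsi k s)
  | qh_epsi k s : qh_rel (xe (swap_at k s) ** xpsi k s) (xpsi k s)
  | qh_yy k m s : qh_rel (xy k s ** xy m s) (xy m s ** xy k s)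
  | qh_psipsi k m s of (k.+1 < m)%N :
      qh_rel (xpsi k (swap_at m s) ** xpsi m s)
             (xpsi m (swap_at k s) ** xpsi k s)
  | qh_psiy k m s of
      ~ (onth s k = onth s k.+1 /\ (m = k \/ m = k.+1)) :
      qh_rel (xpsi k s ** xy m s)
             (xy (adj_transp k m) (swap_at k s) ** xpsi k s)
  | qh_nil1 k s i of onth s k = Some i & onth s k.+1 = Some i :
      qh_rel (xy k s ** xpsi k s - xpsi k s ** xy k.+1 s) (xe s)
  | qh_nil2 k s i of onth s k = Some i & onth s k.+1 = Some i :
      qh_rel (xpsi k s ** xy k s - xy k.+1 s ** xpsi k s) (xe s)
  | qh_quad k s i j of onth s k = Some i & onth s k.+1 = Some j :
      qh_rel (xpsi k (swap_at k s) ** xpsi k s) (xeval (Q i j) k k.+1 s)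
  | qh_braid k s i j l of onth s k = Some i & onth s k.+1 = Some j
                        & onth s k.+2 = Some l :
      qh_rel (xpsi k (swap_at k.+1 (swap_at k s))
                ** xpsi k.+1 (swap_at k s) ** xpsi k s
              - xpsi k.+1 (swap_at k (swap_at k.+1 s))
                ** xpsi k (swap_at k.+1 s) ** xpsi k.+1 s)
             (if (i == l) && (i != j)
              then xdivdiff (Q i j) k k.+1 k.+2 s else EZero).

Variable lam : wtlat D.

Inductive cyc_rel : qexpr -> qexpr -> Prop :=
  | cyc_y i s : cyc_rel (xyn 0 (i :: s) (absz (scoroot i lam)) (xe (i :: s)))
                        EZero.

Definition qh_cyc_rel x y := qh_rel x y \/ cyc_rel x y.

End QuiverHecke.

Definition quiver_hecke (D : kmDatum) (K : fieldType)
    (Q : dynkin D -> dynkin D -> {poly {poly K}}) :=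
  presented (qh_rel Q).

(* Adding relators to a presentation is dividing by the two-sided ideal that  *)
(* they generate: see cyc_qh_quotient.                                        *)
Definition cyc_qh (D : kmDatum) (K : fieldType)
    (Q : dynkin D -> dynkin D -> {poly {poly K}}) (lam : wtlat D) :=
  presented (qh_cyc_rel Q lam).

Section CyclotomicQuotient.
Variables (D : kmDatum) (K : fieldType).
Variable Q : dynkin D -> dynkin D -> {poly {poly K}}.
Variable lam : wtlat D.
Notation R := (quiver_hecke Q).
Notation clsR := (pclass (qh_rel Q)).
Notation cls := (pclass (qh_cyc_rel Q lam)).

Inductive cyc_ideal : R -> Prop :=
  | cyc_ideal_gen i s :
      cyc_ideal (clsR (xyn 0 (i :: s) (absz (scoroot i lam)) (xe K (i :: s))))
  | cyc_ideal0 : cyc_ideal 0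
  | cyc_idealD x y of cyc_ideal x & cyc_ideal y : cyc_ideal (x + y)
  | cyc_idealZ a x of cyc_ideal x : cyc_ideal (a *: x)
  | cyc_idealMl x y of cyc_ideal y : cyc_ideal (x ** y)
  | cyc_idealMr x y of cyc_ideal x : cyc_ideal (x ** y).

Lemma qh_cyc_weaken x y :
  pres_eq (qh_rel Q) x y -> pres_eq (qh_cyc_rel Q lam) x y.
Proof.
move=> xy; elim: xy => *; try by constructor.
- by apply: pres_rel; left.
- by apply: pres_trans; eassumption.
Qed.

Lemma cyc_qh_quotient x y : cls x = cls y <-> cyc_ideal (clsR x - clsR y).
Proof.
have eqI u v : pres_eq (qh_rel Q) u v -> cyc_ideal (clsR u - clsR v).
  by move/pclassP=> ->; rewrite subrr; apply: cyc_ideal0.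
split=> [/pclassP xy|].
  elim: xy => {x y}; try by move=> *; apply: eqI; constructor.
  - move=> x y [xy|[i s]]; first by apply/eqI/pres_rel.
    by rewrite (_ : clsR EZero = 0) // subr0; apply: cyc_ideal_gen.
  - by move=> x y _ H; rewrite -opprB -scaleN1r; apply: cyc_idealZ.
  - by move=> x y z _ H _ H'; rewrite -(subrKA (clsR y)); apply: cyc_idealD.
  - move=> x x' y y' _ H _ H'; rewrite !pclassD opprD addrACA.
    exact: cyc_idealD.
  - by move=> a x x' _ H; rewrite !pclassZ -scalerBr; apply: cyc_idealZ.
  - move=> x x' y y' _ H _ H'; rewrite !pclassM.
    have -> : clsR x ** clsR y - clsR x' ** clsR y'
        = (clsR x - clsR x') ** clsR y + clsR x' ** (clsR y - clsR y').
      rewrite pmulDl pmulDr -!scaleN1r pscaleAl pscaleAr.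
      by rewrite !scaleN1r addrA subrK.
    by apply: cyc_idealD; [apply: cyc_idealMr | apply: cyc_idealMl].
pose phi (z : R) : cyc_qh Q lam := cls (prepr z).
have phiE w : phi (clsR w) = cls w.
  exact/pclassP/qh_cyc_weaken/pclass_repr.
have phiD z w : phi (z + w) = phi z + phi w.
  elim/pclass_ind: z => z; elim/pclass_ind: w => w.
  by rewrite -pclassD !phiE pclassD.
have phiZ a z : phi (a *: z) = a *: phi z.
  by elim/pclass_ind: z => z; rewrite -pclassZ !phiE pclassZ.
have phiM z w : phi (z ** w) = phi z ** phi w.
  elim/pclass_ind: z => z; elim/pclass_ind: w => w.
  by rewrite -pclassM !phiE pclassM.
have phi0 z : cyc_ideal z -> phi z = 0.
  elim=> {z} [i s||z w _ H _ H'|a z _ H|z w _ H|z w _ H].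
  - by rewrite phiE; apply/pclassP/pres_rel; right.
  - by rewrite -(scale0r (0 : R)) phiZ scale0r.
  - by rewrite phiD H H' addr0.
  - by rewrite phiZ H scaler0.
  - by rewrite phiM H pmul0r.
  - by rewrite phiM H pmul0l.
move/phi0; rewrite -scaleN1r phiD phiZ !phiE scaleN1r.
by move/eqP; rewrite subr_eq0 => /eqP.
Qed.

End CyclotomicQuotient.

Section CyclotomicMaps.
Variables (D : kmDatum) (K : fieldType).
Variable Q : dynkin D -> dynkin D -> {poly {poly K}}.
Variable lam : wtlat D.
Notation I := (dynkin D).
Notation Rl := (cyc_qh Q lam).
Notation qexpr := (expr K (qh_gen D)).
Notation cls := (pclass (qh_cyc_rel Q lam)).

Definition eR (s : seq I) : Rl := cls (xe K s).
Definition yR k (s : seq I) : Rl := cls (xy K k s).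
Definition psiR k (s : seq I) : Rl := cls (xpsi K k s).

(* nu i adds a strand labeled i at the right; on the summand of weight mu it  *)
(* is the map nu_i from R_mu to R_(mu - alpha_i).                             *)
Fixpoint xnu (i : I) (x : qexpr) : qexpr :=
  match x with
  | EGen (QHe s) => xe K (rcons s i)
  | EGen (QHy k s) => if (k < size s)%N then xy K k (rcons s i) else EZero
  | EGen (QHpsi k s) => if (k.+1 < size s)%N then xpsi K k (rcons s i) else EZero
  | EZero => EZero
  | EAdd x y => EAdd (xnu i x) (xnu i y)
  | EScale a x => EScale a (xnu i x)
  | EMul x y => EMul (xnu i x) (xnu i y)
  end.

Definition nu (i : I) (x : Rl) : Rl := cls (xnu i (prepr x)).

(* The coefficient of e([::]); by vac_e0l it is the inverse of the            *)
(* isomorphism c |-> c *: e([::]) from K to R_lam.                            *)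
Fixpoint xvac (x : qexpr) : K :=
  match x with
  | EGen (QHe s) => (s == [::])%:R
  | EGen (QHy _ _) => 0
  | EGen (QHpsi _ _) => 0
  | EZero => 0
  | EAdd x y => xvac x + xvac y
  | EScale a x => a * xvac x
  | EMul x y => xvac x * xvac y
  end.

Definition vac (x : Rl) : K := xvac (prepr x).

Lemma onth_lt (T : Type) (s : seq T) k a : onth s k = Some a -> (k < size s)%N.
Proof. by elim: s k => [|b s IH] [|k] //= /IH. Qed.

Lemma onth_rcons (T : Type) (s : seq T) k a : (k < size s)%N ->
  onth (rcons s a) k = onth s k.
Proof. by elim: s k => [|b s IH] [|k] //= /IH. Qed.

Lemma size_swap_at (T : Type) k (s : seq T) : size (swap_at k s) = size s.
Proof.
by elim: k s => [|k IH] [|a s] //=; [case: s | rewrite IH].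
Qed.

Lemma swap_at_rcons (T : Type) k (s : seq T) a : (k.+1 < size s)%N ->
  swap_at k (rcons s a) = rcons (swap_at k s) a.
Proof.
elim: k s => [|k IH] [|b [|c s]] //= H.
by congr (_ :: _); apply: (IH (c :: s)).
Qed.

Local Arguments swap_at : simpl never.

Lemma adj_transp_lt k m n : (k.+1 < n)%N -> (adj_transp k m < n)%N = (m < n)%N.
Proof.
rewrite /adj_transp => H; case: eqP => [->|_]; first by rewrite H (ltnW H).
by case: eqP => [->|//]; rewrite H (ltnW H).
Qed.

Lemma xnu_xyn i k s a x : (k < size s)%N ->
  xnu i (xyn k s a x) = xyn k (rcons s i) a (xnu i x).
Proof. by move=> ks; elim: a => //= a ->; rewrite ks. Qed.

Lemma xnu_big i n (F : 'I_n -> qexpr) :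
  xnu i (\big[@EAdd K (qh_gen D)/EZero]_(b < n) F b)
  = \big[@EAdd K (qh_gen D)/EZero]_(b < n) xnu i (F b).
Proof. by rewrite (big_morph (xnu i) (id1 := EZero) (op1 := @EAdd _ _)). Qed.

Lemma xnu_xeval i p k l s : (k < size s)%N -> (l < size s)%N ->
  xnu i (xeval p k l s) = xeval p k l (rcons s i).
Proof.
move=> ks ls; rewrite /xeval xnu_big; apply: eq_bigr => b _.
by rewrite xnu_big; apply: eq_bigr => a _ /=; rewrite !xnu_xyn.
Qed.

Lemma xnu_xdivdiff i p k l m s :
  (k < size s)%N -> (l < size s)%N -> (m < size s)%N ->
  xnu i (xdivdiff p k l m s) = xdivdiff p k l m (rcons s i).
Proof.
move=> ks ls ms; rewrite /xdivdiff xnu_big; apply: eq_bigr => b _.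
rewrite xnu_big; apply: eq_bigr => a _.
by rewrite xnu_big; apply: eq_bigr => c _ /=; rewrite !xnu_xyn.
Qed.

Lemma pres_mul0 x : pres_eq (qh_cyc_rel Q lam) (EMul EZero x) EZero.
Proof.
apply/pclassP; rewrite pclassM.
exact: pmul0l.
Qed.

Lemma pres_mulx0 x : pres_eq (qh_cyc_rel Q lam) (EMul x EZero) EZero.
Proof.
apply/pclassP; rewrite pclassM.
exact: pmul0r.
Qed.

Lemma xnu_rel i x y : qh_cyc_rel Q lam x y ->
  pres_eq (qh_cyc_rel Q lam) (xnu i x) (xnu i y).
Proof.
pose E := pres_eq (qh_cyc_rel Q lam).
have Erel u v : qh_rel Q u v -> E u v by move=> H; apply: pres_rel; left.
have E0 u : E u u by exact: pres_refl.
have Eml u : E (EMul EZero u) EZero by exact: pres_mul0.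
have Emr u : E (EMul u EZero) EZero by exact: pres_mulx0.
have Etr u v w : E u v -> E v w -> E u w by exact: pres_trans.
have Esy u v : E u v -> E v u by exact: pres_sym.
case; last first.
  case=> j s; apply: pres_rel; right.
  by rewrite xnu_xyn //=; apply: (cyc_y _ _ j (rcons s i)).
case=> {x y}.
- by move=> s; apply: Erel; apply: qh_ee.
- move=> s t st; apply: Erel; apply: qh_ee0 => /rcons_inj[]; exact: st.
- by move=> k s ks /=; rewrite ltnNge ks; exact: E0.
- by move=> k s ks /=; rewrite ltnNge ks; exact: E0.
- by move=> k s /=; case: ifP => _; [apply: Erel; apply: qh_ye | exact: Eml].
- by move=> k s /=; case: ifP => _; [apply: Erel; apply: qh_ey | exact: Emr].
- by move=> k s /=; case: ifP => _; [apply: Erel; apply: qh_psie | exact: Eml].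
- move=> k s /=; case: ifP => ks; last exact: Emr.
  by rewrite -swap_at_rcons //; apply: Erel; apply: qh_epsi.
- move=> k m s /=; case: ifP => ks; case: ifP => ms; try exact: E0.
  + apply: Erel; apply: qh_yy.
  + exact: Etr (Emr _) (Esy _ _ (Eml _)).
  + exact: Etr (Eml _) (Esy _ _ (Emr _)).
- move=> k m s km /=; rewrite !size_swap_at; case: ifP => ks; case: ifP => ms; try exact: E0.
  + by rewrite -!swap_at_rcons //; apply: Erel; apply: qh_psipsi.
  + exact: Etr (Emr _) (Esy _ _ (Eml _)).
  + exact: Etr (Eml _) (Esy _ _ (Emr _)).
- move=> k m s H /=; rewrite !size_swap_at.
  case: (ltnP k.+1 (size s)) => ks; last exact: Etr (Eml _) (Esy _ _ (Emr _)).
  rewrite adj_transp_lt //; case: ifP => ms.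
    rewrite -swap_at_rcons //; apply: Erel; apply: qh_psiy.
    by rewrite !onth_rcons // ltnW.
  exact: Etr (Emr _) (Esy _ _ (Eml _)).
- move=> k s j kj k1j /=; rewrite (onth_lt kj) (onth_lt k1j).
  by apply: Erel; apply: (@qh_nil1 _ _ _ _ _ j); rewrite onth_rcons // ?(onth_lt kj) ?(onth_lt k1j).
- move=> k s j kj k1j /=; rewrite (onth_lt kj) (onth_lt k1j).
  by apply: Erel; apply: (@qh_nil2 _ _ _ _ _ j); rewrite onth_rcons // ?(onth_lt kj) ?(onth_lt k1j).
- move=> k s j l kj k1l /=; have k1s := onth_lt k1l; have ks := onth_lt kj.
  rewrite size_swap_at k1s xnu_xeval // -swap_at_rcons //.
  by apply: Erel; apply: qh_quad; rewrite onth_rcons.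
- move=> k s j l m kj k1l k2m /=.
  have ks := onth_lt kj; have k1s := onth_lt k1l; have k2s := onth_lt k2m.
  rewrite !size_swap_at k1s k2s (fun_if (xnu i)) xnu_xdivdiff //=.
  rewrite -!swap_at_rcons ?size_swap_at //.
  by apply: Erel; apply: qh_braid; rewrite onth_rcons.
Qed.

Lemma nu_class i x : nu i (cls x) = cls (xnu i x).
Proof.
rewrite /nu; apply/pclassP.
suff H u v : pres_eq (qh_cyc_rel Q lam) u v ->
    pres_eq (qh_cyc_rel Q lam) (xnu i u) (xnu i v).
  exact/H/pclass_repr.
move=> uv; elim: uv => *; try by constructor.
- exact: xnu_rel.
- by apply: pres_trans; eassumption.
Qed.

Lemma xvac_xyn k s a x : xvac x = 0 -> xvac (xyn k s a x) = 0 :> K.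
Proof. by case: a => //= a _; rewrite mul0r. Qed.

Lemma xvac_big n (F : 'I_n -> qexpr) : (forall b, xvac (F b) = 0) ->
  xvac (\big[@EAdd K (qh_gen D)/EZero]_(b < n) F b) = 0.
Proof.
move=> F0; elim/big_ind: _ => //= x y -> ->; exact: addr0.
Qed.

Lemma xvac_xeval p k l s : s != [::] -> xvac (xeval p k l s) = 0 :> K.
Proof.
move=> s0; apply: xvac_big => b; apply: xvac_big => a /=.
by rewrite !xvac_xyn ?mulr0 //= (negPf s0).
Qed.

Lemma xvac_xdivdiff p k l m s : s != [::] -> xvac (xdivdiff p k l m s) = 0 :> K.
Proof.
move=> s0; apply: xvac_big => b; apply: xvac_big => a; apply: xvac_big => c /=.
by rewrite !xvac_xyn ?mulr0 //= (negPf s0).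
Qed.

Lemma onth_neq0 (T : eqType) (s : seq T) k a : onth s k = Some a -> s != [::].
Proof. by case: s; rewrite ?onth0n. Qed.

Lemma xvac_rel x y : qh_cyc_rel Q lam x y -> xvac x = xvac y.
Proof.
case; last first.
  by case=> j s; rewrite xvac_xyn.
case=> {x y} /=; rewrite ?mulr0 ?mul0r //.
- by move=> s; case: eqP; rewrite ?mulr1 ?mulr0.
- move=> s t st; case: eqP => [s0|_]; last by rewrite mul0r.
  by case: eqP => [t0|_]; [case: st; rewrite s0 t0 | rewrite mulr0].
- by move=> *; rewrite mul0r.
- by move=> *; rewrite mulr0.
- by move=> *; rewrite mul0r.
- by move=> *; rewrite mulr0.
- by move=> k s i /onth_neq0/negPf ->; rewrite !(mulr0, mul0r, addr0).
- by move=> k s i /onth_neq0/negPf ->; rewrite !(mulr0, mul0r, addr0).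
- by move=> k s i j /onth_neq0 s0; rewrite xvac_xeval ?mul0r.
- move=> k s i j l /onth_neq0 s0; rewrite !(mulr0, mul0r, addr0).
  by case: ifP => // _; rewrite xvac_xdivdiff.
Qed.

Lemma vac_class x : vac (cls x) = xvac x.
Proof.
suff H u v : pres_eq (qh_cyc_rel Q lam) u v -> xvac u = xvac v.
  exact/H/pclass_repr.
move=> uv; elim: uv => //=; try by [move=> *; congruence].
- by move=> *; apply: xvac_rel.
- by move=> *; rewrite addrA.
- by move=> *; rewrite addrC.
- by move=> *; rewrite add0r.
- by move=> *; rewrite mulN1r addNr.
- by move=> *; rewrite mulrA.
- by move=> *; rewrite mul1r.
- by move=> *; rewrite mulrDr.
- by move=> *; rewrite mulrDl.
- by move=> *; rewrite mulrA.
- by move=> *; rewrite mulrDl.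
- by move=> *; rewrite mulrDr.
- by move=> *; rewrite mulrA.
- by move=> *; rewrite mulrCA.
Qed.

Lemma vac_e0 : vac (eR [::]) = 1.
Proof. by rewrite vac_class. Qed.

Lemma vac_e0l x : eR [::] ** x = vac x *: eR [::].
Proof.
have rel u v : qh_rel Q u v -> cls u = cls v.
  by move=> uv; apply/pclassP/pres_rel; left.
have zero : cls EZero = 0 by [].
elim/pclass_ind: x => x; rewrite vac_class /eR.
elim: x => [[s|k s|k s]||x IHx y IHy|a x IHx|x IHx y IHy].
- rewrite -[EGen _]/(xe K s) -pclassM /=; case: eqP => [->|s0].
    by rewrite scale1r; apply/rel/qh_ee.
  by rewrite scale0r -zero; apply/rel/qh_ee0 => /esym.
- rewrite -[EGen _]/(xy K k s) scale0r.
  rewrite -(rel _ _ (qh_ey Q k s)) pclassM pmulA -pclassM.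
  have [->|/eqP s0] := eqVneq s [::].
    have -> : cls (xy K k [::]) = 0 by apply/rel/qh_y0.
    exact: pmul0r.
  rewrite (rel (EMul _ _) EZero); last by apply: qh_ee0 => /esym.
  by rewrite zero pmul0l.
- rewrite -[EGen _]/(xpsi K k s) scale0r.
  rewrite -(rel _ _ (qh_epsi Q k s)) pclassM pmulA -pclassM.
  have [->|/eqP s0] := eqVneq s [::].
    have -> : cls (xpsi K k [::]) = 0 by apply/rel/qh_psi0.
    exact: pmul0r.
  rewrite (rel (EMul _ _) EZero); last first.
    apply: qh_ee0 => /esym/(congr1 size); rewrite size_swap_at.
    by move/size0nil.
  by rewrite zero pmul0l.
- by rewrite /= scale0r zero pmul0r.
- by rewrite pclassD pmulDr IHx IHy -scalerDl.
- by rewrite pclassZ pscaleAr IHx scalerA.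
- by rewrite pclassM pmulA IHx pscaleAl IHy scalerA.
Qed.

End CyclotomicMaps.

Section Action.
Variables (D : kmDatum) (K : fieldType).
Variable Q : dynkin D -> dynkin D -> {poly {poly K}}.
Variable lam : wtlat D.
Notation I := (dynkin D).
Notation X := (wtlat D).
Notation Rl := (cyc_qh Q lam).
Implicit Types (i j k : I) (s : seq I) (mu rho : X) (x y : Rl).
Local Notation e := (@eR D K Q lam).
Local Notation nu := (@nu D K Q lam).

Definition wt s : X := lam - \sum_(i <- s) sroot i.

(* As the simple roots are independent, the sums below are over finitely many *)
(* sequences.                                                                 *)
Definition idR mu : Rl := \sum_(s \in [set s | wt s = mu]%classic) e s.

(* x lies in p R q, for idempotents p and q *)
Definition between (p q x : Rl) : Prop := p ** x = x /\ x ** q = x.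

(* x lies in R_mu, whose unit is idR mu *)
Definition inR mu x : Prop := between (idR mu) (idR mu) x.

(* In R_(mu - alpha_i): the idempotent nu_i(1), the dot on the last strand,   *)
(* and its powers; in R_(mu - alpha_i - alpha_j): the crossing of the last    *)
(* two strands, from labels i, j to labels j, i.                              *)
Definition eF mu i : Rl := nu i (idR mu).

Definition lastdot mu i : Rl :=
  \sum_(s \in [set s | wt s = mu]%classic) yR Q lam (size s) (rcons s i).

Definition lastdotn mu i (n : nat) : Rl := iter n (pmul (lastdot mu i)) (eF mu i).

Definition lastcross mu i j : Rl :=
  \sum_(s \in [set s | wt s = mu]%classic)
    psiR Q lam (size s) (rcons (rcons s i) j).

(* Equality of two formal sums of pure tensors in the tensor product          *)
(* M \otimes_(R_rho) N of a right R_rho-module M, on which R_rho acts through *)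
(* nu_i, and a left R_rho-module N, on which it acts through nu_j: they have  *)
(* the same image under every balanced biadditive map. For M = p R eF rho i   *)
(* and N = eF rho j R q it makes no difference that the maps are taken to be  *)
(* defined on all of Rl, as M and N are direct summands.                      *)
Definition balanced rho i j (Z : zmodType) (f : Rl -> Rl -> Z) : Prop :=
  [/\ forall m m' n, f (m + m') n = f m n + f m' n,
      forall m n n', f m (n + n') = f m n + f m n'
    & forall m n r, inR rho r -> f (m ** nu i r) n = f m (nu j r ** n)].

Definition tensor_eq rho i j (S T : seq (Rl * Rl)) : Prop :=
  forall (Z : zmodType) (f : Rl -> Rl -> Z), balanced rho i j f ->
    \sum_(p <- S) f p.1 p.2 = \sum_(p <- T) f p.1 p.2.

Definition posn (h : int) : nat := if h is Posz n then n else 0.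

(* An action of the Khovanov-Lauda 2-category, in the form of Cautis and      *)
(* Lauda with r_i = 1, on the categories of finitely generated projective     *)
(* right R_mu-modules, in which F_i and E_i are tensoring with the bimodules  *)
(*   F_i 1_mu = eF mu i R_(mu - alpha_i),                                     *)
(*   E_i 1_(mu - alpha_i) = R_(mu - alpha_i) eF mu i                          *)
(* and quiver Hecke elements act on composites of the F_i by left             *)
(* multiplication. A composite of functors is given by the tensor product of  *)
(* the bimodules, and 2-morphisms are given by bimodule maps:                 *)
(*   F_j F_i 1_mu = nu_j(eF mu i) R,   E_i F_i 1_mu = eF mu i R eF mu i,      *)
(*   E_j F_i 1_mu = eF mu i R eF (mu - alpha_i + alpha_j) j,                  *)
(*   F_i E_j 1_mu = R_mu eF rho j \otimes_(R_rho) eF rho i R_(rho - alpha_i)  *)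
(* for rho = mu + alpha_j.                                                    *)
(* The adjunction with F_i left adjoint to E_i has unit nu_i and counit the   *)
(* multiplication m \otimes n |-> m ** n; its triangle identities hold        *)
(* automatically. The other adjunction is the data of the record: its counit  *)
(* is eps mu i : E_i F_i 1_mu -> 1_mu (only the values on eF mu i R eF mu i   *)
(* matter) and its unit 1_mu -> F_i E_i 1_mu sends 1 to the tensor eta mu i.  *)
(* The sideways crossing F_i E_j -> E_j F_i obtained from the first           *)
(* adjunction is m \otimes n |-> nu_i(m) ** lastcross rho i j ** nu_j(n), and *)
(* the sideways crossing E_j F_i -> F_i E_j obtained from the second one is   *)
(* x |-> \sum_((a, b) in eta mu j)                                            *)
(*          a \otimes eps (lastcross rho j i ** nu_i(b) ** x).                *)
Definition bubbleEF (eps : X -> I -> Rl -> Rl) mu i (n : nat) : Rl :=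
  eps mu i (lastdotn mu i n).

Definition bubbleFE (eta : X -> I -> seq (Rl * Rl)) mu i (n : nat) : Rl :=
  \sum_(p <- eta mu i) p.1 ** lastdotn (mu + sroot i) i n ** p.2.

Definition crossFE rho i j m n : Rl :=
  nu i m ** lastcross rho i j ** nu j n.

Definition crossEF (eps : X -> I -> Rl -> Rl) (eta : X -> I -> seq (Rl * Rl))
    mu i j x : seq (Rl * Rl) :=
  let rho := mu + sroot j in
  [seq (p.1, eps (rho - sroot i) j (lastcross rho j i ** nu i p.2 ** x))
     | p <- eta mu j].

Record Uaction := UAction {
  eps : X -> I -> {linear Rl -> Rl};
  eta : X -> I -> seq (Rl * Rl);

  (* The n-th entries have degree 2 d_i n. When they cannot be written with a *)
  (* nonnegative number of dots, they are the fake bubbles, which are         *)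
  (* determined by the inversion formula.                                     *)
  bubEF : X -> I -> nat -> Rl;
  bubFE : X -> I -> nat -> Rl;

  eps_in : forall mu i x,
    between (eF mu i) (eF mu i) x -> inR mu (eps mu i x);
  eps_bimod : forall mu i b c x, inR mu b -> inR mu c ->
    between (eF mu i) (eF mu i) x ->
    eps mu i (nu i b ** x ** nu i c) = b ** eps mu i x ** c;
  eta_in : forall mu i p, p \in eta mu i ->
    between (idR mu) (eF (mu + sroot i) i) p.1 /\
    between (eF (mu + sroot i) i) (idR mu) p.2;
  eta_bimod : forall mu i r, inR mu r ->
    tensor_eq (mu + sroot i) i i
      [seq (r ** p.1, p.2) | p <- eta mu i]
      [seq (p.1, p.2 ** r) | p <- eta mu i];

  (* triangle identities for E_i left adjoint to F_i *)
  triangleE : forall mu i x, between (idR mu) (eF (mu + sroot i) i) x ->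
    \sum_(p <- eta mu i) p.1 ** nu i (eps (mu + sroot i) i (p.2 ** x)) = x;
  triangleF : forall mu i x, between (eF (mu + sroot i) i) (idR mu) x ->
    \sum_(p <- eta mu i) nu i (eps (mu + sroot i) i (x ** p.1)) ** p.2 = x;

  (* dots are cyclic, and crossings are so up to t_ij / t_ji *)
  dot_cyclic : forall mu i x, between (eF mu i) (eF mu i) x ->
    eps mu i (lastdot mu i ** x) = eps mu i (x ** lastdot mu i);
  cross_cyclic_eq : forall mu i x,
    between (nu i (eF mu i)) (nu i (eF mu i)) x ->
    eps mu i (eps (mu - sroot i) i (x ** lastcross mu i i))
    = eps mu i (eps (mu - sroot i) i (lastcross mu i i ** x));
  cross_cyclic_neq : forall mu i j x, i != j ->
    between (nu j (eF mu i)) (nu i (eF mu j)) x ->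
    tcoef Q i j *: eps mu i (eps (mu - sroot i) j (x ** lastcross mu i j))
    = tcoef Q j i *: eps mu j (eps (mu - sroot j) i (lastcross mu i j ** x));

  (* bubbles; an EF-bubble on mu with n dots has degree 2 d_i (n + 1 - mu^i)  *)
  (* and an FE-bubble has degree 2 d_i (n + 1 + mu^i)                         *)
  bubbleEF_neg : forall mu i (n : nat), n%:Z + 1 - scoroot i mu < 0 ->
    bubbleEF eps mu i n = 0;
  bubbleFE_neg : forall mu i (n : nat), n%:Z + 1 + scoroot i mu < 0 ->
    bubbleFE eta mu i n = 0;
  bubEF_real : forall mu i (n c : nat), n%:Z + 1 - scoroot i mu = c%:Z ->
    bubEF mu i c = bubbleEF eps mu i n;
  bubFE_real : forall mu i (n c : nat), n%:Z + 1 + scoroot i mu = c%:Z ->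
    bubFE mu i c = bubbleFE eta mu i n;
  bubEF0 : forall mu i, bubEF mu i 0 = idR mu;
  bubFE0 : forall mu i, bubFE mu i 0 = idR mu;
  bub_inversion : forall mu i (n : nat), (0 < n)%N ->
    \sum_(c < n.+1) bubEF mu i c ** bubFE mu i (n - c) = 0;

  (* oppositely oriented strands of different colors *)
  mixedEF : forall mu i j x, i != j ->
    between (eF mu i) (eF (mu + sroot j - sroot i) j) x ->
    \sum_(p <- crossEF eps eta mu i j x) crossFE (mu + sroot j) i j p.1 p.2
    = tcoef Q j i *: x;
  mixedFE : forall mu i j m n, i != j ->
    between (idR mu) (eF (mu + sroot j) j) m ->
    between (eF (mu + sroot j) i) (idR (mu + sroot j - sroot i)) n ->
    tensor_eq (mu + sroot j) j i
      (crossEF eps eta mu i j (crossFE (mu + sroot j) i j m n))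
      [:: (tcoef Q j i *: m, n)];

  (* oppositely oriented strands of the same color *)
  sl2EF : forall mu i x, between (eF mu i) (eF mu i) x ->
    let h := posn (scoroot i mu) in
    x + \sum_(p <- crossEF eps eta mu i i x) crossFE (mu + sroot i) i i p.1 p.2
    = \sum_(a < h) \sum_(b < h - a)
        lastdotn mu i a
          ** nu i (bubFE mu i (h - 1 - a - b) ** eps mu i (lastdotn mu i b ** x));
  sl2FE : forall mu i m n,
    between (idR mu) (eF (mu + sroot i) i) m ->
    between (eF (mu + sroot i) i) (idR mu) n ->
    let h := posn (- scoroot i mu) in
    let rho := mu + sroot i in
    tensor_eq rho i i
      ((m, n) :: crossEF eps eta mu i i (crossFE rho i i m n))
      [seq (p.1 ** lastdotn rho i ab.1,
            p.2 ** bubEF mu i (h - 1 - ab.1 - ab.2)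
                ** (m ** lastdotn rho i ab.2 ** n))
         | ab <- [seq (a, b) | a <- iota 0 h, b <- iota 0 (h - a)],
           p <- eta mu i]
}.

Variable U : Uaction.

(* For x in e(s) R_(mu - ...) e(s), close all strands of s at the right, the  *)
(* last one first; the leftmost strand starts at the weight mu.               *)
Fixpoint close_right mu s x : Rl :=
  if s is i :: s' then eps U mu i (close_right (mu - sroot i) s' x) else x.

(* The nested units send 1 to e(s), on which x acts by left multiplication.   *)
(* Only finitely many e(s) x e(s) are nonzero.                                *)
Definition tr_lam x : K :=
  \sum_(s \in [set: seq I]%classic) vac (close_right lam s (e s ** x ** e s)).

Definition left_ideal (L : Rl -> Prop) : Prop :=
  [/\ L 0, forall x y, L x -> L y -> L (x - y)
    & forall a x, L x -> L (a ** x)].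

Definition Frobenius_trace (tr : Rl -> K) : Prop :=
  (forall a x y, tr (a *: x + y) = a * tr x + tr y) /\
  (forall L, left_ideal L -> (forall x, L x -> tr x = 0) ->
     forall x, L x -> x = 0).

End Action.

(* Main.v *)
Require Import Defs.
From HB Require Import structures.
From mathcomp Require Import all_boot all_order all_algebra.
From mathcomp Require Import boolp classical_sets cardinality fsbigop finmap.

(** By the triangle identity for the unit [eta] and the counit [eps] of
    [E_i -| F_i], an [x] in [R_(rho - alpha_i) nu_i(1)] equals
    [\sum_p p.1 nu_i (eps (p.2 x))], so it vanishes as soon as [eps (c x) = 0]
    for all [c].  As [eps] is [R_rho]-linear, peeling off the last strand shows,
    by induction on [s], that the pairing of [e(s) R] with [R e(s)] given by
    closing at the right is nondegenerate in the second argument; at [s = [::]]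
    it is the multiplication of [R_lam = K].  Every [x] is a finite sum of its
    components [x e(s)], so no nonzero left ideal is killed by the trace. *)

Set Implicit Arguments.
Unset Strict Implicit.
Unset Printing Implicit Defensive.

Import GRing.Theory.
Local Open Scope ring_scope.

(** * Weights of label sequences *)

Section Weights.
Variables (D : kmDatum) (lam : wtlat D).
Notation I := (dynkin D).
Implicit Types s t : seq I.

(** Puts a weight in the form of an integer combination indexed by the vertices, to which
    [sroot_free] applies. *)
Lemma sum_sroot_count s :
  \sum_(i <- s) sroot i = \sum_(i : I) sroot i *~ (count_mem i s)%:Z.
Proof.
elim: s => [|j s IH]; first by rewrite big_nil big1.
rewrite big_cons IH [RHS](eq_bigr (fun i =>
  sroot i *~ (i == j)%:Z + sroot i *~ (count_mem i s)%:Z)); last first.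
  by move=> i _ /=; rewrite PoszD mulrzDr eq_sym.
rewrite big_split /=; congr (_ + _).
rewrite (bigD1 j) //= eqxx mulr1z big1 ?addr0 // => i /negPf ->.
by rewrite mulr0z.
Qed.

(** Independence of the simple roots forces each label to have the same multiplicity in both
    sequences. *)
Lemma wt_inj_perm s t : wt lam s = wt lam t -> perm_eq s t.
Proof.
move=> /(congr1 (fun x => lam - x)); rewrite /wt !subKr => st.
apply/permP => a; apply/permP/allP: a => i _ /=; apply/eqP.
have := @sroot_free D (fun i => (count_mem i s)%:Z - (count_mem i t)%:Z).
have -> : \sum_i sroot i *~ ((count_mem i s)%:Z - (count_mem i t)%:Z) = 0.
  under eq_bigr => j _ do rewrite mulrzBr.
  by rewrite sumrB -!sum_sroot_count st subrr.
by move=> /(_ erefl i)/eqP; rewrite subr_eq0 => /eqP[].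
Qed.

Lemma perm_wt s t : perm_eq s t -> wt lam s = wt lam t.
Proof. by move=> st; rewrite /wt (perm_big _ st). Qed.

Lemma wt_rcons s i : wt lam (rcons s i) = wt lam s - sroot i.
Proof. by rewrite /wt -cats1 big_cat big_seq1 opprD addrA. Qed.

Lemma wt_nil : wt lam [::] = lam.
Proof. by rewrite /wt big_nil subr0. Qed.

(** All sequences of one weight are permutations of any one of them. Sums over an infinite support
    are 0 by convention, so this finiteness makes [idR mu] the honest sum of its idempotents. *)
Lemma finite_wt mu : finite_set [set s | wt lam s = mu]%classic.
Proof.
have [[s <-]|no] := pselect (exists s, wt lam s = mu).
  apply: (sub_finite_set _ (finite_seq (permutations s))) => t /= /wt_inj_perm.
  by rewrite mem_permutations.
by apply: (sub_finite_set _ (finite_set0 _)) => s /= ?; apply: no; exists s.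
Qed.

Lemma swap_at_perm k s : perm_eq (swap_at k s) s.
Proof.
elim: k s => [|k IH] [|a s] //=; last by rewrite perm_cons.
case: s => //= b s; by rewrite -[b :: a :: s]/([:: b] ++ [:: a] ++ s)
  -[a :: b :: s]/([:: a] ++ [:: b] ++ s) perm_catCA.
Qed.

End Weights.

(** * The idempotents [e s], the central elements [idR mu], and finite local units *)

Section Idempotents.
Variables (D : kmDatum) (K : fieldType).
Variables (Q : dynkin D -> dynkin D -> {poly {poly K}}) (lam : wtlat D).
Notation I := (dynkin D).
Notation Rl := (cyc_qh Q lam).
Notation cls := (pclass (qh_cyc_rel Q lam)).
Local Notation e := (@eR D K Q lam).
Local Notation idR := (@idR D K Q lam).
Local Notation nu := (@nu D K Q lam).
Implicit Types (s t : seq I) (x y : Rl).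

Lemma qh_rel_cls u v : qh_rel Q u v -> cls u = cls v.
Proof. by move=> uv; apply/pclassP/pres_rel; left. Qed.

Lemma eR_mul s t : e s ** e t = if s == t then e s else 0.
Proof.
rewrite /eR -pclassM; case: eqP => [->|st].
  exact/qh_rel_cls/qh_ee.
exact/qh_rel_cls/qh_ee0.
Qed.

Lemma eR_idem s : e s ** e s = e s.
Proof. by rewrite eR_mul eqxx. Qed.

Lemma pmul_suml (J : Type) (r : seq J) (F : J -> Rl) x :
  (\sum_(j <- r) F j) ** x = \sum_(j <- r) F j ** x.
Proof.
apply: (big_morph (fun z => z ** x)) => [u v|]; [exact: pmulDl|exact: pmul0l].
Qed.

Lemma pmul_sumr (J : Type) (r : seq J) (F : J -> Rl) x :
  x ** (\sum_(j <- r) F j) = \sum_(j <- r) x ** F j.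
Proof.
apply: (big_morph (fun z => x ** z)) => [u v|]; [exact: pmulDr|exact: pmul0r].
Qed.

Lemma eR_sum s (r : seq (seq I)) : uniq r ->
  e s ** (\sum_(t <- r) e t) = if s \in r then e s else 0.
Proof.
move=> Ur; rewrite pmul_sumr; case: ifP => sr.
  rewrite (bigD1_seq s) //= eR_idem big1 ?addr0 // => t /negPf ts.
  by rewrite eR_mul eq_sym ts.
by rewrite big1_seq // => t /andP[_ tr]; rewrite eR_mul; case: eqP tr sr => // -> ->.
Qed.

Lemma sum_eR s (r : seq (seq I)) : uniq r ->
  (\sum_(t <- r) e t) ** e s = if s \in r then e s else 0.
Proof.
move=> Ur; rewrite pmul_suml; case: ifP => sr.
  rewrite (bigD1_seq s) //= eR_idem big1 ?addr0 // => t /negPf ts.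
  by rewrite eR_mul ts.
by rewrite big1_seq // => t /andP[_ tr]; rewrite eR_mul; case: eqP tr sr => // -> ->.
Qed.

Lemma idR_enum mu : exists r : seq (seq I),
  [/\ uniq r, forall s, (s \in r) = (wt lam s == mu) & idR mu = \sum_(s <- r) e s].
Proof.
exists (fset_set [set s | wt lam s = mu]%classic); split.
- exact: fset_uniq.
- move=> s; rewrite in_fset_set; last exact: finite_wt.
  by apply/idP/eqP => [/set_mem //|smu]; apply: mem_set.
- by rewrite /Defs.idR fsbig_finite //; exact: finite_wt.
Qed.

Lemma eR_idR s mu : e s ** idR mu = if wt lam s == mu then e s else 0.
Proof. by have [r [Ur rE ->]] := idR_enum mu; rewrite eR_sum // rE. Qed.

Lemma idR_eR s mu : idR mu ** e s = if wt lam s == mu then e s else 0.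
Proof. by have [r [Ur rE ->]] := idR_enum mu; rewrite sum_eR // rE. Qed.

Lemma idR_lam : idR lam = e [::].
Proof.
rewrite /Defs.idR (_ : [set s | wt lam s = lam]%classic = [set [::]]%classic).
  by rewrite fsbig_set1.
apply/seteqP; split=> s /= => [|->]; last exact: wt_nil.
by rewrite -[RHS]wt_nil => /wt_inj_perm/perm_size/size0nil.
Qed.

(** Every nonzero generator expression runs between sequences that are permutations of each other,
    hence of one weight, so [idR mu] acts on both sides by the same 0 or 1. *)
Lemma idR_comm mu x : idR mu ** x = x ** idR mu.
Proof.
have homog z s t : e t ** z = z -> z ** e s = z -> wt lam t = wt lam s ->
    idR mu ** z = z ** idR mu.
  move=> tz zs ts; rewrite -{1}tz -{2}zs pmulA -(pmulA z) idR_eR eR_idR ts.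
  by case: eqP; rewrite ?pmul0l ?pmul0r // tz zs.
elim/pclass_ind: x; elim=> [[s|k s|k s]||u IHu v IHv|a u IHu|u IHu v IHv].
- by apply: (homog _ s s) => //; apply: eR_idem.
- apply: (homog _ s s) => //; rewrite -pclassM; apply: qh_rel_cls.
    exact: qh_ey.
  exact: qh_ye.
- apply: (homog _ s (swap_at k s)); last exact/perm_wt/swap_at_perm.
    by rewrite -pclassM; apply/qh_rel_cls/qh_epsi.
  by rewrite -pclassM; apply/qh_rel_cls/qh_psie.
- by rewrite (_ : cls EZero = 0) // pmul0l pmul0r.
- by rewrite pclassD pmulDr IHu IHv pmulDl.
- by rewrite pclassZ pscaleAr IHu pscaleAl.
- by rewrite pclassM pmulA IHu -pmulA IHv pmulA.
Qed.

(** An expression involves finitely many generators, each fixed on the right by a single [e s]; this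
    replaces a unit. *)
Lemma finite_right_unit x :
  exists2 r : seq (seq I), uniq r & x ** (\sum_(s <- r) e s) = x.
Proof.
have gen z s : z ** e s = z ->
    exists2 r : seq (seq I), uniq r & z ** (\sum_(s <- r) e s) = z.
  by move=> zs; exists [:: s]; rewrite ?big_seq1.
elim/pclass_ind: x; elim=> [[s|k s|k s]||u IHu v IHv|a u [r Ur rE]|u _ v [r Ur rE]].
- by apply: (gen _ s); apply: eR_idem.
- by apply: (gen _ s); rewrite -pclassM; apply/qh_rel_cls/qh_ye.
- by apply: (gen _ s); rewrite -pclassM; apply/qh_rel_cls/qh_psie.
- by exists [::]; rewrite // (_ : cls EZero = 0) // pmul0l.
- have [r1 U1 E1] := IHu; have [r2 U2 E2] := IHv.
  exists (undup (r1 ++ r2)); first exact: undup_uniq.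
  (* A local right unit stays one when its list grows, so both summands share the merged list. *)
  have absorb (r r' : seq (seq I)) z : uniq r' -> {subset r <= r'} ->
      z ** (\sum_(s <- r) e s) = z -> z ** (\sum_(s <- r') e s) = z.
    move=> U' rr' zr; rewrite -[z in LHS]zr -pmulA pmul_suml.
    by rewrite (eq_big_seq e) // => s /rr' sr'; rewrite eR_sum // sr'.
  rewrite pclassD pmulDl; congr (_ + _).
    by apply: (absorb r1) => // [|s sr]; rewrite ?undup_uniq // mem_undup mem_cat sr.
  apply: (absorb r2) => // [|s sr]; rewrite ?undup_uniq //.
  by rewrite mem_undup mem_cat sr orbT.
- by exists r; rewrite // pclassZ pscaleAl rE.
- by exists r; rewrite // pclassM -pmulA rE.
Qed.

Lemma mul_eR_ext0 x : (forall s, x ** e s = 0) -> x = 0.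
Proof.
move=> x0; have [r _ <-] := finite_right_unit x.
by rewrite pmul_sumr big1.
Qed.

Lemma vacM x y : vac (x ** y) = vac x * vac y.
Proof.
elim/pclass_ind: x => x; elim/pclass_ind: y => y.
by rewrite -pclassM !vac_class.
Qed.

Lemma vac_linear a x y : vac (a *: x + y) = a * vac x + vac y.
Proof.
elim/pclass_ind: x => x; elim/pclass_ind: y => y.
by rewrite -pclassZ -pclassD !vac_class.
Qed.

Lemma nuM i x y : nu i (x ** y) = nu i x ** nu i y.
Proof.
elim/pclass_ind: x => x; elim/pclass_ind: y => y.
by rewrite -pclassM !nu_class -pclassM.
Qed.

Lemma nu0 i : nu i (0 : Rl) = 0.
Proof. by rewrite -[0 : Rl]/(cls EZero) nu_class. Qed.

Lemma nu_eR i s : nu i (e s) = e (rcons s i).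
Proof. by rewrite /eR nu_class. Qed.

End Idempotents.

(** * Closing at the right, the trace, and nondegeneracy *)

Section RightClosure.
Variables (D : kmDatum) (K : fieldType).
Variables (Q : dynkin D -> dynkin D -> {poly {poly K}}) (lam : wtlat D).
Variable U : Uaction Q lam.
Notation I := (dynkin D).
Notation Rl := (cyc_qh Q lam).
Local Notation e := (@eR D K Q lam).
Local Notation idR := (@idR D K Q lam).
Local Notation nu := (@nu D K Q lam).
Local Notation eF := (@eF D K Q lam).
Implicit Types (s t : seq I) (x y : Rl) (mu : wtlat D).

Lemma close_right_linear mu s a x y :
  close_right U mu s (a *: x + y)
  = a *: close_right U mu s x + close_right U mu s y.
Proof. by elim: s mu => [|i s IH] mu //=; rewrite IH linearP. Qed.

(** [close_right] recurses on the first label, while the later induction removes the last one, whose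
    strand is closed first. *)
Lemma close_right_rcons mu s i x :
  close_right U mu (rcons s i) x
  = close_right U mu s (eps U (mu - \sum_(j <- s) sroot j) i x).
Proof.
elim: s mu => [|j s IH] mu /=; first by rewrite big_nil subr0.
by rewrite IH big_cons opprD addrA.
Qed.

Definition closure s x : K := vac (close_right U lam s (e s ** x ** e s)).

Lemma closure_linear s a x y :
  closure s (a *: x + y) = a * closure s x + closure s y.
Proof.
by rewrite /closure pmulDr pmulDl pscaleAr pscaleAl close_right_linear vac_linear.
Qed.

Lemma closure0 s : closure s 0 = 0.
Proof. by have := closure_linear s (-1) 0 0; rewrite scaler0 addr0 mulN1r addNr. Qed.

Lemma closure_eq0 s x : x ** e s = 0 -> closure s x = 0.
Proof.
by move=> xs; rewrite -(closure0 s) /closure -!pmulA xs pmul0l.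
Qed.

Lemma tr_lam_sum x (r : seq (seq I)) : uniq r ->
  (forall s, s \notin r -> closure s x = 0) ->
  tr_lam U x = \sum_(s <- r) closure s x.
Proof.
move=> Ur xr; rewrite /tr_lam (fsbigE r) // => [|s _]; last exact: xr.
by apply: eq_bigl => s; apply: mem_set.
Qed.

(** Since infinite supports give 0, additivity is checked over one finite list that supports both
    [x] and [y]. *)
Lemma tr_lam_linear a x y : tr_lam U (a *: x + y) = a * tr_lam U x + tr_lam U y.
Proof.
have supp z r s : uniq r -> z ** (\sum_(t <- r) e t) = z -> s \notin r ->
    closure s z = 0.
  move=> Ur zr /negPf sr; apply: closure_eq0.
  by rewrite -zr -pmulA sum_eR // sr pmul0r.
have [r1 U1 E1] := finite_right_unit x; have [r2 U2 E2] := finite_right_unit y.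
have Ur := undup_uniq (r1 ++ r2).
have xr s : s \notin undup (r1 ++ r2) -> closure s x = 0.
  by rewrite mem_undup mem_cat negb_or => /andP[/(supp _ _ _ U1 E1)].
have yr s : s \notin undup (r1 ++ r2) -> closure s y = 0.
  by rewrite mem_undup mem_cat negb_or => /andP[_ /(supp _ _ _ U2 E2)].
rewrite (tr_lam_sum Ur xr) (tr_lam_sum Ur yr) (tr_lam_sum Ur); last first.
  by move=> s sr; rewrite closure_linear xr ?yr // mulr0 addr0.
by rewrite mulr_sumr -big_split; apply: eq_bigr => s _; exact: closure_linear.
Qed.

Lemma tr_lam_eR s x : e s ** x = x -> tr_lam U x = closure s x.
Proof.
move=> sx; rewrite (tr_lam_sum (r := [:: s])) ?big_seq1 // => t.
rewrite inE => /negPf ts; rewrite -(closure0 t) /closure.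
by rewrite -sx (pmulA (e t)) eR_mul ts pmul0l pmul0r.
Qed.

Lemma close_right_nondegenerate s y : y ** e s = y ->
  (forall a, vac (close_right U lam s (e s ** a ** y)) = 0) -> y = 0.
Proof.
elim/last_ind: s y => [|s i IH] y ys H.
  (* By centrality of [idR lam], [y] is a multiple of [e [::]]; pairing with [a = e [::]] reads off
     the scalar. *)
  have idy : e [::] ** y = y by rewrite -idR_lam idR_comm idR_lam ys.
  rewrite -idy vac_e0l.
  by have := H (e [::]); rewrite /= !vacM !vac_e0 !mul1r => ->; rewrite scale0r.
set rho := wt lam s.
have nu_s : nu i (e s) = e (rcons s i) by exact: nu_eR.
have es_id : e s ** idR rho = e s by rewrite eR_idR eqxx.
have id_es : idR rho ** e s = e s by rewrite idR_eR eqxx.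
have yF : y ** eF rho i = y.
  by rewrite -ys -pmulA -nu_s -nuM es_id.
have id_id : idR rho ** idR rho = idR rho.
  have [r [Ur rE {2 3}->]] := idR_enum Q lam rho.
  rewrite pmul_sumr; apply: eq_big_seq => t.
  by rewrite rE idR_eR => ->.
(* The induction hypothesis will be applied to [eps U rho i (c ** y)]. *)
have eps0 c : eF rho i ** c = c -> eps U rho i (c ** y) = 0.
  move=> Fc; have cyF : between (eF rho i) (eF rho i) (c ** y).
    by split; rewrite ?pmulA ?Fc // -pmulA yF.
  have id_in : inR rho (idR rho) by [].
  have es_in : inR rho (e s) by [].
  have [id_eps eps_id] := eps_in U cyF.
  apply: IH => [|b].
    (* Right linearity turns [y ** e (rcons s i) = y] into invariance of [eps U rho i (c ** y)]
       under [e s]. *)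
    have := eps_bimod U id_in es_in cyF.
    rewrite nu_s -!pmulA ys (pmulA (nu i _)) Fc.
    by rewrite (pmulA (idR rho)) id_eps => <-.
  (* Linearity of [eps] needs a coefficient in the summand of weight [rho], so [b] is truncated; the
     extra [idR rho] is absorbed by [eps U rho i (c ** y)]. *)
  set b' := e s ** b ** idR rho.
  have b'_in : inR rho b'.
    split; rewrite /b'.
      by rewrite !pmulA id_es.
    by rewrite -pmulA id_id.
  have := eps_bimod U b'_in id_in cyF.
  rewrite -!pmulA eps_id yF /b' -!pmulA id_eps pmulA => <-.
  have := H (nu i (b ** idR rho) ** c).
  by rewrite close_right_rcons -/(wt lam s) -nu_s pmulA -nuM -!pmulA.
(* The triangle identity expands [y]; each [p.2] is fixed on the left by [eF rho i], so [eps0] kills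
   every term. *)
have := @triangleE _ _ _ _ U (rho - sroot i) i y; rewrite subrK => <-.
  rewrite big1_seq // => p /andP[_ /(eta_in)[_]]; rewrite subrK => -[Fp _].
  by rewrite eps0 // nu0 pmul0r.
by split=> //; rewrite idR_comm -ys -pmulA eR_idR wt_rcons eqxx.
Qed.

End RightClosure.

Theorem theorem3p18 (D : kmDatum) (K : fieldType)
  (Q : dynkin D -> dynkin D -> {poly {poly K}}) (hQ : Qparams Q)
  (lam : wtlat D) (hlam : dominant lam) (U : Uaction Q lam) :
  Frobenius_trace (tr_lam U).
Proof.
split=> [a x y|L [_ _ LM] L0 x Lx]; first exact: tr_lam_linear.
apply: mul_eR_ext0 => s.
apply: (@close_right_nondegenerate _ _ _ _ U s) => [|a].
  by rewrite -pmulA eR_idem.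
(* The left factor [e s] leaves only the summand of the trace at [s], and closing supplies the right
   factor [e s]. *)
have /L0 := LM (eR Q lam s ** a) x Lx.
rewrite (@tr_lam_eR _ _ _ _ U s) ?pmulA ?eR_idem // /closure.
by rewrite !pmulA eR_idem.
Qed.
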